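(* Every quadric surface in $\mathbb{P}^3$ (the zero scheme of a nonzero quadratic form over $\mathbb{C}$, of any rank) is a Poncelet quadric, i.e. a Poncelet surface of degree $2$.
   Context: Work over $\mathbb{C}$. Let $V$ be a complex vector space of dimension $2$ and $S_i=\mathrm{Sym}^i(V)$, viewed as the space of binary forms of degree $i$ (so $\dim S_i=i+1$). Let $\mathbb{P}(S_n^\vee)\cong\mathbb{P}^n$ denote the projective space whose points are the lines $[h]$ in $S_n$, so that its linear forms are the elements of $S_n^\vee$. For integers $n\ge 1$, $k\ge 0$, multiplication of binary forms $S_k\otimes S_n\to S_{n+k}$ defines the Schwarzenberger bundle $E_{n,n+k}$, of rank $n$ on $\mathbb{P}(S_n^\vee)$, by the exact sequence $$0\to S_k\otimes\mathcal{O}_{\mathbb{P}(S_n^\vee)}(-1)\to S_{n+k}\otimes\mathcal{O}_{\mathbb{P}(S_n^\vee)}\to E_{n,n+k}\to 0,$$ where at the point $[h]$ the first map is $g\mapsto gh$. One has $H^0(E_{n,n+k})\cong S_{n+k}$, so binary forms of degree $n+k$ are sections of $E_{n,n+k}$. For $1\le r\le n$ and linearly independent sections $f_1,\dots,f_r\in S_{n+k}$ of $E_{n,n+k}$, the Poncelet variety defined by them is the closed subscheme of $\mathbb{P}(S_n^\vee)$ with equation $f_1\wedge\cdots\wedge f_r=0$ (vanishing of this section of $\bigwedge^r E_{n,n+k}$). When $r=n$ it is a Poncelet hypersurface of degree $k+1$; writing $\Lambda=\langle f_1,\dots,f_n\rangle$, its equation is the determinant of the induced $(k+1)\times(k+1)$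 matrix of linear forms $S_k\otimes\mathcal{O}(-1)\to (S_{n+k}/\Lambda)\otimes\mathcal{O}$. A subscheme of $\mathbb{P}^n$ is called a Poncelet variety (hypersurface) if it becomes one under some linear isomorphism $\mathbb{P}^n\cong\mathbb{P}(S_n^\vee)$ (equivalently, for some choice of a rational normal curve in $\mathbb{P}^n$). A Poncelet surface of degree $d$ is a Poncelet hypersurface in $\mathbb{P}^3$ with $n=3$, $k=d-1$. *)

(* Defs.v *)
From HB Require Import structures.
From mathcomp Require Import all_boot all_order all_algebra.
From mathcomp Require Import complex reals.
From mathcomp Require Import mpoly.

Set Implicit Arguments.
Unset Strict Implicit.
Unset Printing Implicit Defensive.

Import GRing.Theory.
Local Open Scope ring_scope.

Section Poncelet.

Variable K : fieldType.

(* S_i = Sym^i(V) with dim V = 2; [dhomog 2 K i] carries the library's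
   [vectType] structure, of dimension i + 1. *)
Definition bform (i : nat) := dhomog 2 K i.

Definition bform_mul (n k : nat) (h : bform n) (g : bform k) : bform (n + k) :=
  DHomog (dhomogM (dhomog_is_dhomog h) (dhomog_is_dhomog g)).

Lemma bmonom_homog (k : nat) (j : 'I_k.+1) :
  ('X_0 ^+ (k - j) * 'X_1 ^+ j : {mpoly K[2]}) \is k.-homog.
Proof.
have X1 (i : 'I_2) : ('X_i : {mpoly K[2]}) \is 1.-homog.
  by rewrite dhomogX; apply/eqP; exact: mdeg1.
have := dhomogM (dhomogMn (k - j) (X1 0)) (dhomogMn j (X1 1)).
by rewrite !mul1n subnK // -ltnS.
Qed.

Definition bmonom (k : nat) (j : 'I_k.+1) : bform k := DHomog (bmonom_homog j).

(* The map S_k (x) O(-1) -> (S_{n+k} / Lambda) (x) O on P(S_n^\vee), pulled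
   back along the linear isomorphism of P^n with P(S_n^\vee) that sends
   [a_0 : ... : a_n] to the line of [phi a].  The quotient S_{n+k} / Lambda is
   presented by a surjection [pi] onto K^(k+1) with kernel Lambda, and S_k by
   its monomial basis.  Row j is the image of the j-th monomial g_j: its l-th
   entry is the linear form in a given by the l-th coordinate of
   pi (phi a * g_j). *)
Definition poncelet_mx (n k : nat) (phi : 'Hom('rV[K]_n.+1, bform n))
    (pi : 'Hom(bform (n + k), 'rV[K]_k.+1)) : 'M[{mpoly K[n.+1]}]_k.+1 :=
  \matrix_(j < k.+1, l < k.+1)
     \sum_(i < n.+1)
        (pi (bform_mul (phi (delta_mx 0 i)) (bmonom j)) 0 l) *: 'X_i.

(* Equality of the ideals (F) and (G).  For forms in at least two variables
   principal ideals are saturated, so this says that F = 0 and G = 0 are the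
   same closed subscheme of projective space (with multiplicities). *)
Definition same_zero_scheme (m : nat) (F G : {mpoly K[m]}) : Prop :=
  forall P : {mpoly K[m]}, (exists A, P = A * F) <-> (exists B, P = B * G).

(* The zero scheme of F in P^n (n >= 1) is a Poncelet hypersurface, of degree
   k + 1: for some linear isomorphism of P^n with P(S_n^\vee) it is the
   hypersurface f_1 /\ ... /\ f_n = 0 defined by linearly independent sections
   f_1, ..., f_n in S_{n+k} of E_{n,n+k}.  The choice of [pi] only multiplies
   the determinant by a nonzero constant. *)
Definition is_poncelet_hypersurface (n k : nat) (F : {mpoly K[n.+1]}) : Prop :=
  exists (phi : 'Hom('rV[K]_n.+1, bform n)) (f : n.-tuple (bform (n + k)))
         (pi : 'Hom(bform (n + k), 'rV[K]_k.+1)),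
    [/\ bijective phi,
        free f,
        lker pi = <<f>>%VS,
        limg pi = fullv
      & same_zero_scheme F (\det (poncelet_mx phi pi))].

Definition is_poncelet_surface (d : nat) (F : {mpoly K[4]}) : Prop :=
  (0 < d)%N /\ is_poncelet_hypersurface (n := 3) d.-1 F.

End Poncelet.

(* Main.v *)
From HB Require Import structures.
Require Import Defs.
From mathcomp Require Import all_boot all_order all_algebra.
From mathcomp Require Import complex reals.
From mathcomp Require Import mpoly.
From mathcomp Require Import ring.

(** A quadric surface is a Poncelet quadric because the Poncelet quadrics
    already exhaust the four ranks, and over an algebraically closed field the
    rank of a quadratic form is its only invariant under linear changes of
    coordinates.

    Take for Lambda the span of all monomials X_0^(4-m) X_1^m of degree 4 except
    those with m = p0 and m = p1, where p0 < p1.  Then S_4 / Lambda has as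
    coordinates the coefficients of the two missing monomials, and for
    h = sum_m L_m X_0^(3-m) X_1^m the class of h X_j has coordinates
    L_(p0-j) and L_(p1-j), with L_m = 0 unless 0 <= m <= 3.  So the Poncelet
    quadric is
      L_p0 L_(p1-1) - L_p1 L_(p0-1) = 0,
    where L_0, ..., L_3 are arbitrary independent linear forms, namely the ones
    that define the isomorphism of P^3 with P(S_3^\vee)
    ([monomial_poncelet], [monomial_poncelet_quadric]).  The choices
      (p0, p1) = (0, 1), (0, 2), (1, 2), (1, 3)
    give
      L_0^2,  L_0 L_1,  L_1^2 - L_0 L_2,  L_1 L_2 - L_0 L_3,
    of ranks 1, 2, 3 and 4.

    On the other side, a quadratic form in n variables is y_1^2 + ... + y_r^2 for
    independent linear forms y_1, ..., y_n ([quadratic_form_sum_squares]); this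
    is the congruence of a complex symmetric matrix to a partial identity
    ([symmetric_congr_pid]).  Splitting a^2 + b^2 as (a + ib)(a - ib) then turns
    the sum of squares into the form of the same rank in the list. *)

Set Implicit Arguments.
Unset Strict Implicit.
Unset Printing Implicit Defensive.
Import GRing.Theory Num.Theory.
Local Open Scope ring_scope.

(** * Congruence of complex symmetric matrices *)

(** By polarization, a symmetric form that vanishes on every vector is zero, as
    2 is invertible; a square root then normalizes the value to 1. *)
Lemma symmetric_anisotropic (C : numClosedFieldType) n (A : 'M[C]_n) :
  A^T = A -> A != 0 -> exists v : 'rV_n, v *m A *m v^T = 1%:M.
Proof.
move=> symA nzA.
suff [w nzw] : exists w : 'rV_n, (w *m A *m w^T) 0 0 != 0.
  set a := _ 0 0 in nzw; exists ((sqrtC a)^-1 *: w).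
  rewrite linearZ /= -!scalemxAl -scalemxAr scalerA (mx11_scalar (_ *m _)).
  by rewrite -/a scale_scalar_mx -expr2 exprVn sqrtCK mulVf.
have entryE i j :
    ((delta_mx 0 i : 'rV_n) *m A *m (delta_mx 0 j : 'rV_n)^T) 0 0 = A i j.
  by rewrite -rowE trmx_delta -colE !mxE.
have [/existsP[i Aii] | /existsPn iso] := boolP [exists i, A i i != 0].
  by exists (delta_mx 0 i); rewrite entryE.
have [i [j Aij]] : exists i j, A i j != 0.
  have /existsP[i /existsP[j Aij]] : [exists i, exists j, A i j != 0].
    apply: contraNT nzA => /existsPn A0; apply/eqP/matrixP => i j.
    by have /existsPn/(_ j)/negbNE/eqP-> := A0 i; rewrite mxE.
  by exists i, j.
exists (delta_mx 0 i + delta_mx 0 j).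
rewrite linearD /= !mulmxDl !mulmxDr.
have addE (X Y : 'M[C]_1) : (X + Y) 0 0 = X 0 0 + Y 0 0 by rewrite mxE.
rewrite !addE !entryE.
rewrite (eqP (negbNE (iso i))) (eqP (negbNE (iso j))) add0r addr0.
have -> : A j i = A i j by rewrite -{1}symA mxE.
by rewrite -mulr2n mulrn_eq0.
Qed.

Lemma unitmx_with_row0 (F : fieldType) n (v : 'rV[F]_n.+1) :
  v != 0 -> exists2 P : 'M_n.+1, P \in unitmx & row 0 P = v.
Proof.
move=> nzv; pose e : 'rV[F]_n.+1 := delta_mx 0 0.
have e1 : e *m (e^T *m v) = v.
  by rewrite mulmxA trmx_delta mul_delta_mx [delta_mx _ _]mx11_scalar mxE mul1mx.
have [] := @complete_unitmx _ _ _ e (e^T *m v).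
  by rewrite e1 mxrank_delta rank_rV nzv.
by move=> P unitP; rewrite e1 -rowE => /esym rowP; exists P.
Qed.

Lemma pid_mxS (F : fieldType) n r :
  pid_mx r.+1 = block_mx 1%:M 0 0 (pid_mx r) :> 'M[F]_(1 + n).
Proof.
apply/matrixP => i j; rewrite !mxE.
by do ![case: split_ordP => ? -> /[!mxE]]; rewrite ?ord1 //=.
Qed.

(** Gram-Schmidt: in a basis starting with a vector of norm 1, one elimination
    step by [L] splits off that vector, and induction applies to its orthogonal
    complement.  The zero matrix stops the induction, so the 1s come first. *)
Lemma symmetric_congr_pid (C : numClosedFieldType) n (A : 'M[C]_n) :
  A^T = A -> exists2 P, P \in unitmx & exists2 r, (r <= n)%N &
    P *m A *m P^T = pid_mx r.
Proof.
elim: n A => [|n IHn] A symA.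
  by exists 1%:M; [exact: unitmx1 | exists 0%N => //; apply/matrixP => -[]].
have [-> | nzA] := eqVneq A 0.
  exists 1%:M; [exact: unitmx1 | exists 0%N => //].
  by rewrite mulmx0 mul0mx pid_mx_0.
have [v vAv] := symmetric_anisotropic symA nzA.
have nzv : v != 0.
  apply: contra_eq_neq vAv => ->; rewrite !mul0mx.
  by apply/eqP => /matrixP/(_ 0 0)/eqP; rewrite !mxE eq_sym oner_eq0.
have [P unitP rowP] := unitmx_with_row0 nzv.
pose B : 'M_(1 + n) := P *m A *m P^T.
have symB : B^T = B by rewrite !trmx_mul trmxK symA mulmxA.
have ulB : ulsubmx B = 1%:M.
  rewrite -vAv -rowP; apply/matrixP => i j; rewrite !ord1 !mxE.
  apply: eq_bigr => k _; rewrite !mxE; congr (_ * _); last first.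
    by congr (P _ _); apply: val_inj.
  by apply: eq_bigr => l _; rewrite !mxE; congr (P _ _ * _); apply: val_inj.
pose b := ursubmx B; pose D := drsubmx B.
have dlB : dlsubmx B = b^T by rewrite -{1}symB trmx_ursub.
have symD : D^T = D by rewrite trmx_drsub symB.
have defB : B = block_mx 1%:M b b^T D by rewrite -ulB -dlB submxK.
pose L : 'M_(1 + n) := block_mx 1%:M 0 (- b^T) 1%:M.
have LBL : L *m B *m L^T = block_mx 1%:M 0 0 (D - b^T *m b).
  rewrite defB tr_block_mx !mulmx_block !trmx1 !trmx0 linearN /= trmxK.
  rewrite !(mul1mx, mulmx1, mul0mx, mulmx0, addr0, add0r) mulNmx.
  by rewrite !addNr mul0mx add0r addrC.
have [|Q unitQ [r le_r_n QDQ]] := IHn (D - b^T *m b).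
  by rewrite linearB /= trmx_mul trmxK symD.
pose Q1 : 'M_(1 + n) := block_mx 1%:M 0 0 Q.
have unitQ1 : Q1 \in unitmx by rewrite unitmxE det_lblock det1 mul1r -unitmxE.
have unitL : L \in unitmx by rewrite unitmxE det_lblock !det1 mul1r unitr1.
exists (Q1 *m L *m P); first by rewrite !unitmx_mul unitQ1 unitL unitP.
exists r.+1 => //; rewrite pid_mxS -QDQ.
transitivity (Q1 *m (L *m B *m L^T) *m Q1^T).
  by rewrite /B !trmx_mul !mulmxA.
rewrite LBL tr_block_mx !mulmx_block !trmx1 !trmx0.
by rewrite !(mul1mx, mulmx1, mul0mx, mulmx0, addr0, add0r).
Qed.

(** * Quadratic forms as sums of squares *)

(** The linear forms whose coefficients are the columns of [T]. *)
Definition linear_forms (K : fieldType) n (T : 'M[K]_n) : 'rV[{mpoly K[n]}]_n :=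
  \row_i 'X_i *m map_mx (@mpolyC n K) T.

Lemma linear_formsM (K : fieldType) n (T U : 'M[K]_n) :
  linear_forms (T *m U) = linear_forms T *m map_mx (@mpolyC n K) U.
Proof. by rewrite /linear_forms map_mxM mulmxA. Qed.

Lemma linear_formsE (K : fieldType) n (T : 'M[K]_n) m :
  linear_forms T 0 m = \sum_i T i m *: 'X_i.
Proof.
by rewrite mxE; apply: eq_bigr => i _; rewrite !mxE mulrC mul_mpolyC.
Qed.

(** Some matrix exists because it does for each monomial of degree 2; averaging
    it with its transpose makes it symmetric. *)
Lemma quadratic_form_mx (K : fieldType) n (q : {mpoly K[n]}) :
  (2%:R : K) != 0 -> q \is 2.-homog ->
  exists2 A : 'M[K]_n, A^T = A &
    q%:M = \row_i 'X_i *m map_mx (@mpolyC n K) A *m (\row_i 'X_i)^T.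
Proof.
move=> nz2 /dhomogP homq; set X := \row_i _.
suff [A qA] : exists A : 'M[K]_n, q%:M = X *m map_mx (@mpolyC n K) A *m X^T.
  exists (2%:R^-1 *: (A + A^T)).
    by rewrite linearZ linearD /= trmxK addrC.
  have qAT : q%:M = X *m map_mx (@mpolyC n K) A^T *m X^T.
    by rewrite -tr_scalar_mx qA !trmx_mul trmxK map_trmx mulmxA.
  rewrite map_mxZ map_mxD -scalemxAr -scalemxAl mulmxDr mulmxDl -qA -qAT.
  rewrite -mulr2n -scaler_nat scalerA -[X in _ * X](rmorph_nat (@mpolyC n K)).
  by rewrite -rmorphM mulVf // rmorph1 scale1r.
rewrite (mpolyE q) big_seq.
apply: (big_ind (fun f : {mpoly K[n]} => exists A : 'M[K]_n,
  f%:M = X *m map_mx (@mpolyC n K) A *m X^T)).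
- by exists 0; rewrite map_mx0 mulmx0 mul0mx raddf0.
- move=> f g [A fA] [B gB]; exists (A + B).
  by rewrite map_mxD mulmxDr mulmxDl -fA -gB raddfD.
move=> m /homq /= deg_m.
have [i [j ->]] : exists i j, m = (U_(i) + U_(j))%MM.
  have /existsP[i mi] : [exists i, (0 < m i)%N].
    apply: contra_eqT deg_m => /existsPn m0.
    by rewrite mdegE big1 // => i _; apply/eqP; rewrite -leqn0 leqNgt m0.
  have le_im : (U_(i) <= m)%MM.
    by apply/mnm_lepP => l; rewrite mnm1E; case: eqP => // <-.
  have : mdeg (m - U_(i))%MM == 1%N.
    by rewrite -(eqn_add2r (mdeg U_(i))) -mdegD submK // deg_m mdeg1.
  by case/mdeg1P => j /eqP mj; exists i, j; rewrite -mj addmC submK.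
exists (q@_(U_(i) + U_(j)) *: delta_mx i j).
rewrite map_mxZ map_delta_mx -scalemxAr -scalemxAl.
rewrite -[delta_mx i j](mul_delta_mx (0 : 'I_1)) mulmxA -colE -mulmxA -rowE.
rewrite [RHS]mx11_scalar !mxE big_ord1 !mxE mpolyXD.
by rewrite mul_mpolyC.
Qed.

Lemma quadratic_form_sum_squares (C : numClosedFieldType) n (q : {mpoly C[n]}) :
  q \is 2.-homog -> exists2 P : 'M[C]_n, P \in unitmx &
    exists2 r, (r <= n)%N & q = \sum_(i < n | (i < r)%N) linear_forms P 0 i ^+ 2.
Proof.
move=> homq; have nz2 : (2%:R : C) != 0 by rewrite pnatr_eq0.
have [A symA qA] := quadratic_form_mx nz2 homq.
have [P unitP [r le_rn PAP]] := symmetric_congr_pid symA.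
exists (invmx P); first by rewrite unitmx_inv.
exists r => //; set Y := linear_forms _.
have defA : A = invmx P *m pid_mx r *m (invmx P)^T.
  rewrite -PAP trmx_inv -!mulmxA mulmxV ?unitmx_tr // mulmx1 mulmxA.
  by rewrite mulVmx // mul1mx.
have : q%:M = Y *m pid_mx r *m Y^T :> 'M_1.
  rewrite qA defA !map_mxM map_pid_mx -map_trmx.
  rewrite /Y /linear_forms; move: (map_mx _ (invmx P)) (\row_i 'X_i) => Q X.
  by rewrite trmx_mul !mulmxA.
clearbody Y => /matrixP/(_ 0 0); rewrite !mxE eqxx mulr1n => ->.
rewrite [RHS]big_mkcond; apply: eq_bigr => i _.
rewrite !mxE (bigD1 i) //= !mxE eqxx big1 ?addr0 => [|j ne_ji].
  by case: (i < r)%N; rewrite ?mulr1 ?mulr0 ?mul0r.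
by rewrite !mxE (negPf (_ : val j != val i)) ?mulr0.
Qed.

(** * Coefficients of binary forms *)

Definition bexp (d m : nat) : 'X_{1..2} := (U_(0%R) *+ (d - m) + U_(1%R) *+ m)%MM.

Lemma bmonomE (K : fieldType) k (j : 'I_k.+1) :
  bmonom K j = 'X_[bexp k j] :> {mpoly K[2]}.
Proof. by rewrite /= mpolyXD !mpolyXn. Qed.

Lemma bexpD n k m j : (m <= n)%N -> (j <= k)%N ->
  (bexp n m + bexp k j)%MM = bexp (n + k) (m + j).
Proof.
move=> le_mn le_jk; apply/mnmP => i.
by rewrite !(mnmDE, mulmnE) subnDA -addnBAC // -addnBA // !mulnDr addnACA.
Qed.

Lemma bexp_inj d : injective (bexp d).
Proof.
by move=> m p /mnmP/(_ 1); rewrite !(mnmDE, mulmnE, mnm1E) !eqxx /= !mul1n.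
Qed.

Lemma dim_bform (K : fieldType) d : \dim {: bform K d} = d.+1.
Proof. by rewrite dimvf /dim /= addn1 binSn. Qed.

Definition bform_comb (K : fieldType) n (a : 'rV[K]_n.+1) : bform K n :=
  \sum_m a 0 m *: bmonom K m.

Lemma bform_combE (K : fieldType) n (a : 'rV[K]_n.+1) :
  bform_comb a = \sum_m a 0 m *: 'X_[bexp n m] :> {mpoly K[2]}.
Proof. by rewrite raddf_sum; apply: eq_bigr => m _; rewrite -bmonomE. Qed.

Lemma bform_comb_is_linear (K : fieldType) n : linear (@bform_comb K n).
Proof.
move=> c a b; rewrite /bform_comb scaler_sumr -big_split /=.
by apply: eq_bigr => m _; rewrite !mxE scalerDl scalerA.
Qed.

HB.instance Definition _ (K : fieldType) n :=
  GRing.isLinear.Build K _ _ _ (@bform_comb K n) (@bform_comb_is_linear K n).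

Definition bform_coef (K : fieldType) d s (p : 'I_s -> nat) (g : bform K d)
  : 'rV[K]_s := \row_l (g : {mpoly K[2]})@_(bexp d (p l)).

Lemma bform_coef_is_linear (K : fieldType) d s (p : 'I_s -> nat) :
  linear (@bform_coef K d s p).
Proof. by move=> c g h; apply/rowP => l; rewrite !mxE mcoeffD mcoeffZ. Qed.

HB.instance Definition _ (K : fieldType) d s (p : 'I_s -> nat) :=
  GRing.isLinear.Build K _ _ _ (@bform_coef K d s p)
    (@bform_coef_is_linear K d s p).

(** Multiplication by the j-th monomial shifts the coefficients by j; this is
    what makes the entries of the matrices below the forms L_(p - j). *)
Lemma bform_coef_mul (K : fieldType) n k s (p : 'I_s -> nat) (a : 'rV[K]_n.+1)
    (j : 'I_k.+1) l :
  bform_coef p (bform_mul (bform_comb a) (bmonom K j)) 0 l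
    = \sum_(m < n.+1 | (m + j)%N == p l) a 0 m.
Proof.
rewrite mxE /bform_mul; set h := bform_comb a.
rewrite (_ : mpoly_of_dhomog _
  = (h : {mpoly K[2]}) * (bmonom K j : {mpoly K[2]})) // bmonomE bform_combE.
rewrite mulr_suml raddf_sum [RHS]big_mkcond /=; apply: eq_bigr => m _.
rewrite -scalerAl -mpolyXD mcoeffZ mcoeffX bexpD -1?ltnS //.
by rewrite (inj_eq (@bexp_inj _)); case: eqP; rewrite ?mulr1 ?mulr0.
Qed.

Lemma bform_coef_comb (K : fieldType) n s (p : 'I_s -> nat) (a : 'rV[K]_n.+1) l :
  bform_coef p (bform_comb a) 0 l = \sum_(m < n.+1 | m == p l :> nat) a 0 m.
Proof.
rewrite mxE bform_combE raddf_sum /= [RHS]big_mkcond.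
apply: eq_bigr => m _; rewrite mcoeffZ mcoeffX.
by rewrite (inj_eq (@bexp_inj _)); case: eqP; rewrite ?mulr1 ?mulr0.
Qed.

Lemma bform_comb_inj (K : fieldType) n : injective (@bform_comb K n).
Proof.
move=> a b eq_ab; apply/rowP => m.
have := congr1 (fun g => bform_coef (@nat_of_ord n.+1) g 0 m) eq_ab.
by rewrite !bform_coef_comb !(big_pred1 m).
Qed.

Lemma bform_coef_surj (K : fieldType) d s (p : 'I_s -> 'I_d.+1) :
  injective p -> forall a : 'rV[K]_s, exists g : bform K d, bform_coef p g = a.
Proof.
move=> inj_p a; exists (bform_comb (\sum_l a 0 l *: delta_mx 0 (p l))).
apply/rowP => l; rewrite bform_coef_comb (big_pred1 (p l)) // summxE.
rewrite (bigD1 l) //= !mxE !eqxx mulr1 big1 ?addr0 // => i ne_il.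
by rewrite !mxE (inj_eq inj_p) eq_sym (negPf ne_il) mulr0.
Qed.

(** * Poncelet hypersurfaces with Lambda spanned by monomials *)

Lemma inj_lfun_bij (K : fieldType) (uT vT : vectType K) (f : 'Hom(uT, vT)) :
  injective f -> \dim {:uT} = \dim {:vT} -> bijective f.
Proof.
move=> /lker0P kerf dimE; exists (f^-1)%VF; first exact: lker0_lfunK.
move=> y; apply: limg_lfunVK.
suff /eqP-> : limg f == fullv by rewrite memvf.
by rewrite eqEdim subvf -dimE limg_dim_eq ?leqnn // (eqP kerf) capv0.
Qed.

(** Here Lambda is the span of the monomials whose exponents are not values of
    [p]: the quotient map reads off the coefficients at the values of [p].  The
    condition m + j = p l selects at most one m, so the sum is the form
    L_(p l - j), or 0 when this index is not between 0 and n. *)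
Lemma monomial_poncelet (K : fieldType) n k (p : 'I_k.+1 -> 'I_(n + k).+1)
    (T : 'M[K]_n.+1) :
  injective p -> T \in unitmx ->
  is_poncelet_hypersurface k
    (\det (\matrix_(j < k.+1, l < k.+1)
             \sum_(m < n.+1 | (m + j)%N == p l) linear_forms T 0 m)).
Proof.
move=> inj_p unitT.
pose phi : 'Hom('rV[K]_n.+1, bform K n) := linfun (@bform_comb K n \o mulmxr T).
pose pi : 'Hom(bform K (n + k), 'rV[K]_k.+1) := linfun (bform_coef p).
have pi_onto : limg pi = fullv.
  apply/eqP; rewrite eqEsubv subvf; apply/subvP => a _.
  have [g <-] := bform_coef_surj inj_p a.
  by rewrite -(lfunE (bform_coef p)) memv_img ?memvf.
have dim_ker : \dim (lker pi) = n.
  have := limg_ker_dim pi fullv.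
  rewrite capfv pi_onto dim_bform dimvf /dim /= mul1n -addnS.
  exact: addIn.
have sz : size (vbasis (lker pi)) == n by rewrite size_tuple dim_ker.
exists phi, (Tuple sz), pi; split.
- apply: inj_lfun_bij; last by rewrite dim_bform dimvf /dim /= mul1n.
  move=> a b; rewrite !lfunE /= => /bform_comb_inj.
  exact: (can_inj (mulmxK unitT)).
- exact: basis_free (vbasisP _).
- exact/esym/span_basis/vbasisP.
- exact: pi_onto.
suff -> : poncelet_mx phi pi = \matrix_(j < k.+1, l < k.+1)
   \sum_(m < n.+1 | (m + j)%N == p l) linear_forms T 0 m by [].
apply/matrixP => j l; rewrite !mxE.
under [RHS]eq_bigr do rewrite linear_formsE.
rewrite exchange_big; apply: eq_bigr => i _.
rewrite !lfunE /= bform_coef_mul scaler_suml.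
by apply: eq_bigr => m _; rewrite -rowE mxE.
Qed.

(** The sum [H j p] is L_(p-j), so this quadric is
    L_p0 L_(p1-1) - L_p1 L_(p0-1) = 0. *)
Lemma monomial_poncelet_quadric (K : fieldType) (T : 'M[K]_4) (p0 p1 : nat) :
  (p0 < p1 < 5)%N -> T \in unitmx ->
  let H j p := \sum_(m < 4 | (m + j)%N == p) linear_forms T 0 m in
  is_poncelet_surface 2 (H 0%N p0 * H 1%N p1 - H 0%N p1 * H 1%N p0).
Proof.
case/andP=> lt_p lt_p1 unitT H; split=> //.
have lt_p0 : (p0 < 5)%N := ltn_trans lt_p lt_p1.
pose p (l : 'I_2) : 'I_5 := if l == 0 then Ordinal lt_p0 else Ordinal lt_p1.
have inj_p : injective p.
  move=> [[|[|//]] lt_l] [[|[|//]] lt_l'] /(congr1 val) /= eq_p.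
  - exact: val_inj.
  - by rewrite eq_p ltnn in lt_p.
  - by rewrite eq_p ltnn in lt_p.
  - exact: val_inj.
have := @monomial_poncelet K 3 1 p T inj_p unitT.
rewrite (expand_det_row _ 0) !big_ord_recl big_ord0 /cofactor !det_mx11 !mxE /=.
rewrite [_ ^+ (0 + 0)]expr0 [_ ^+ (0 + bump 0 0)]expr1.
by rewrite addr0 mul1r mulN1r mulrN.
Qed.

(** * The four ranks *)

Definition mx4 (K : fieldType) (s : seq (seq K)) : 'M[K]_4 :=
  \matrix_(i, j) (nth [::] s i)`_j.

Lemma linear_forms_mx4 (K : fieldType) (P : 'M[K]_4) s m :
  linear_forms (P *m mx4 s) 0 m =
    \sum_(a < 4) (nth [::] s a)`_m *: linear_forms P 0 a.
Proof.
rewrite linear_formsM mxE; apply: eq_bigr => a _.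
by rewrite !mxE mulrC mul_mpolyC.
Qed.

Lemma sum_ord4 (V : nmodType) (F : 'I_4 -> V) (Q : pred nat) :
  \sum_(m < 4 | Q m) F m =
    (if Q 0 then F (inord 0) else 0) + (if Q 1 then F (inord 1) else 0)
    + (if Q 2 then F (inord 2) else 0) + (if Q 3 then F (inord 3) else 0).
Proof.
rewrite big_mkcond !big_ord_recr big_ord0 /= add0r.
by congr (_ + _ + _ + _); case: ifP => // _; congr F; apply: val_inj;
   rewrite /= inordK.
Qed.

(** The sum of squares in y_0, ..., y_3 is matched with the monomial Poncelet
    quadric of the same rank.  In ranks 2, 3 and 4 the forms L_m are the columns
    of the first table, in the coordinates y_a, and the second table is its
    inverse; in rank 1 the forms L_m are the y_m themselves. *)
Lemma quadric_is_poncelet (C : numClosedFieldType) (q : {mpoly C[4]}) :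
  q \is 2.-homog -> q != 0 -> is_poncelet_surface 2 q.
Proof.
move=> /quadratic_form_sum_squares[P unitP [r le_r4 ->]].
have sqrI : 'i ^+ 2 = -1 :> C by rewrite sqrCi.
have sqrIp : ('i : C)%:MP ^+ 2 = -1 :> {mpoly C[4]}.
  by rewrite -rmorphXn sqrI rmorphN1.
have reduce (s t : seq (seq C)) p0 p1 F : (p0 < p1 < 5)%N ->
    mx4 s *m mx4 t = 1%:M ->
    (forall L : 'I_4 -> {mpoly C[4]},
       (forall m, L m = \sum_(a < 4) (nth [::] s a)`_m *: linear_forms P 0 a) ->
       let H j p := \sum_(m < 4 | (m + j)%N == p) L m in
       F = H 0%N p0 * H 1%N p1 - H 0%N p1 * H 1%N p0) ->
    is_poncelet_surface 2 F.
  move=> lt_p /mulmx1_unit[unit_s _] /(_ _ (linear_forms_mx4 P s)) ->.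
  by apply: monomial_poncelet_quadric; rewrite // unitmx_mul unitP.
case: r le_r4 => [|[|[|[|[|//]]]]] _ nzq.
- by rewrite big_pred0_eq eqxx in nzq.
-
  (* rank 1: L_0 L_0 *)
  have := monomial_poncelet_quadric (isT : 0 < 1 < 5)%N unitP.
  rewrite /= !(sum_ord4 _ (fun m => m + _ == _)%N)
    (sum_ord4 _ (fun m => m < _)%N) /=.
  by rewrite !addr0 !add0r !mulr0 subr0 -expr2.
-
  (* rank 2: L_0 L_1 = (y_0 + i y_1) (y_0 - i y_1) *)
  apply: (reduce
    [:: [:: 1; 1; 0; 0];
        [:: 'i; - 'i; 0; 0];
        [:: 0; 0; 1; 0];
        [:: 0; 0; 0; 1]]
    [:: [:: 2^-1; - 'i / 2; 0; 0];
        [:: 2^-1; 'i / 2; 0; 0];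
        [:: 0; 0; 1; 0];
        [:: 0; 0; 0; 1]]
    0 2); first by [].
    apply/matrixP => -[[|[|[|[|//]]]] ?] [[|[|[|[|//]]]] ?];
      rewrite !mxE (sum_ord4 _ xpredT) !mxE !inordK //=;
      by field: sqrI.
  move=> L LE; rewrite /= !(sum_ord4 _ (fun m => m + _ == _)%N)
    (sum_ord4 _ (fun m => m < _)%N) /= !LE.
  rewrite !(sum_ord4 _ xpredT) !inordK //=.
  rewrite -!mul_mpolyC !rmorphN !rmorph0 !rmorph1.
  by ring: sqrIp.
-
  (* rank 3: L_1 L_1 - L_2 L_0 = y_0^2 - (- y_1 + i y_2) (y_1 + i y_2) *)
  apply: (reduce
    [:: [:: 0; 1; 0; 0];
        [:: 1; 0; -1; 0];
        [:: 'i; 0; 'i; 0];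
        [:: 0; 0; 0; 1]]
    [:: [:: 0; 2^-1; - 'i / 2; 0];
        [:: 1; 0; 0; 0];
        [:: 0; - 2^-1; - 'i / 2; 0];
        [:: 0; 0; 0; 1]]
    1 2); first by [].
    apply/matrixP => -[[|[|[|[|//]]]] ?] [[|[|[|[|//]]]] ?];
      rewrite !mxE (sum_ord4 _ xpredT) !mxE !inordK //=;
      by field: sqrI.
  move=> L LE; rewrite /= !(sum_ord4 _ (fun m => m + _ == _)%N)
    (sum_ord4 _ (fun m => m < _)%N) /= !LE.
  rewrite !(sum_ord4 _ xpredT) !inordK //=.
  rewrite -!mul_mpolyC !rmorphN !rmorph0 !rmorph1.
  by ring: sqrIp.
-
  (* rank 4: L_1 L_2 - L_3 L_0
     = (y_0 + i y_1) (y_0 - i y_1) - (- y_2 + i y_3) (y_2 + i y_3) *)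
  apply: (reduce
    [:: [:: 0; 1; 1; 0];
        [:: 0; 'i; - 'i; 0];
        [:: 1; 0; 0; -1];
        [:: 'i; 0; 0; 'i]]
    [:: [:: 0; 0; 2^-1; - 'i / 2];
        [:: 2^-1; - 'i / 2; 0; 0];
        [:: 2^-1; 'i / 2; 0; 0];
        [:: 0; 0; - 2^-1; - 'i / 2]]
    1 3); first by [].
    apply/matrixP => -[[|[|[|[|//]]]] ?] [[|[|[|[|//]]]] ?];
      rewrite !mxE (sum_ord4 _ xpredT) !mxE !inordK //=;
      by field: sqrI.
  move=> L LE; rewrite /= !(sum_ord4 _ (fun m => m + _ == _)%N)
    (sum_ord4 _ (fun m => m < _)%N) /= !LE.
  rewrite !(sum_ord4 _ xpredT) !inordK //=.
  rewrite -!mul_mpolyC !rmorphN !rmorph0 !rmorph1.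
  by ring: sqrIp.
Qed.

Theorem mainTheorem1 (R : realType) (q : {mpoly R[i][4]}) :
  q \is 2.-homog -> q != 0 -> is_poncelet_surface 2 q.
Proof. exact: quadric_is_poncelet. Qed.
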